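(* Scale Invariance, Richness and Monotonic Consistency are mutually compatible clustering axioms: for every finite set $X$ with at least three points there exists a clustering algorithm $F$ on $X$ that simultaneously satisfies Scale Invariance, Richness and Monotonic Consistency.
   Context: A distance on a finite set $X$ is a function $d\colon X\times X\to\mathbb{R}$ with $d(i,j)=d(j,i)\ge 0$ and $d(i,j)=0$ if and only if $i=j$ (the triangle inequality is not required). A clustering algorithm on $X$ is a map $F$ from the set of distances on $X$ to the set of partitions of $X$. For a partition $\mathcal{P}$, write $x\sim_{\mathcal{P}}y$ if $x,y$ lie in the same cluster (block) of $\mathcal{P}$, and $x\not\sim_{\mathcal{P}}y$ otherwise. A map $\eta\colon[0,\infty)\to[0,\infty)$ is expansive if it is continuous and $|\eta(x)-\eta(y)|\ge|x-y|$ for all $x,y$. An expansive map $[0,\infty)\to[0,\infty)$ with $\eta(0)=0$ is a bijection. Given a distance $d$ and a partition $\mathcal{P}$ of $X$, a $\mathcal{P}$-monotonic transformation of $d$ is any distance $d'$ on $X$ such that, for some expansive map $\eta\colon[0,\infty)\to[0,\infty)$ (necessarily with $\eta(0)=0$) and all $x,y\in X$: $d(x,y)=\eta(d'(x,y))$ if $x\sim_{\mathcal{P}}y$, and $d(x,y)=\eta^{-1}(d'(x,y))$ if $x\not\sim_{\mathcal{P}}y$. Axioms for $F$. Scale Invariance: $F(\alpha\cdot d)=F(d)$ for every distance $d$ and every $\alpha>0$. Richness: for every partition $\mathcal{P}$ of $X$ there is a distance $d$ on $X$ with $F(d)=\mathcal{P}$. Monotonic Consistency: $F(d')=F(d)$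 whenever $d'$ is an $F(d)$-monotonic transformation of $d$. *)

(* Defs.v *)
From HB Require Import structures.
From mathcomp Require Import all_boot all_order all_algebra.
From mathcomp Require Import all_classical all_reals all_analysis.

Set Implicit Arguments.
Unset Strict Implicit.
Unset Printing Implicit Defensive.

Import Order.TTheory GRing.Theory Num.Theory.
Import numFieldNormedType.Exports.

Local Open Scope classical_set_scope.
Local Open Scope ring_scope.

Record distance (R : realType) (X : finType) := Distance {
  dist_fun :> X -> X -> R;
  dist_sym : forall x y, dist_fun x y = dist_fun y x;
  dist_ge0 : forall x y, 0 <= dist_fun x y;
  dist_eq0 : forall x y, dist_fun x y = 0 <-> x = y }.

Section Scale.
Variables (R : realType) (X : finType) (a : R) (a_gt0 : 0 < a).
Variable d : distance R X.

Let scale_fun (x y : X) : R := a * d x y.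

Let scale_sym x y : scale_fun x y = scale_fun y x.
Proof. by rewrite /scale_fun dist_sym. Qed.

Let scale_ge0 x y : 0 <= scale_fun x y.
Proof. exact: mulr_ge0 (ltW a_gt0) (dist_ge0 d x y). Qed.

Let scale_eq0 x y : scale_fun x y = 0 <-> x = y.
Proof.
rewrite -(dist_eq0 d); split; last by rewrite /scale_fun => ->; rewrite mulr0.
by move/eqP; rewrite mulf_eq0 (gt_eqF a_gt0) => /eqP.
Qed.

Definition scale_distance : distance R X :=
  Distance scale_sym scale_ge0 scale_eq0.

End Scale.

Definition partition_of (X : finType) : Type :=
  {P : {set {set X}} | finset.partition P [set: X]%SET}.

Definition same_cluster (X : finType) (P : partition_of X) (x y : X) : bool :=
  y \in finset.pblock (val P) x.

Definition clustering_algorithm (R : realType) (X : finType) : Type :=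
  distance R X -> partition_of X.

(* Maps [0, +oo) -> [0, +oo) are represented by maps R -> R of which only the
   restriction to [0, +oo) is ever constrained or used. *)
Definition expansive (R : realType) (eta : R -> R) : Prop :=
  [/\ forall t, 0 <= t -> 0 <= eta t,
      {within `[0, +oo[, continuous eta} &
      forall s t, 0 <= s -> 0 <= t -> `|s - t| <= `|eta s - eta t|].

(* The inverse of the bijection of [0, +oo) induced by eta, when eta 0 = 0;
   see expansive_bij and monotonic_transformation_eta0. *)
Definition half_line_inv (R : realType) (eta : R -> R) : R -> R :=
  'pinv_(fun=> 0) `[0, +oo[ eta.

Definition transforms_by (R : realType) (X : finType) (P : partition_of X)
    (eta : R -> R) (d d' : distance R X) : Prop :=
  forall x y : X,
    (same_cluster P x y -> d x y = eta (d' x y)) /\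
    (~~ same_cluster P x y -> d x y = half_line_inv eta (d' x y)).

(* d' is a P-monotonic transformation of d. *)
Definition monotonic_transformation (R : realType) (X : finType)
    (P : partition_of X) (d d' : distance R X) : Prop :=
  exists2 eta : R -> R, expansive eta & transforms_by P eta d d'.

Definition scale_invariance (R : realType) (X : finType)
    (F : clustering_algorithm R X) : Prop :=
  forall (d : distance R X) (a : R) (a_gt0 : 0 < a),
    F (scale_distance a_gt0 d) = F d.

Definition richness (R : realType) (X : finType)
    (F : clustering_algorithm R X) : Prop :=
  forall P : partition_of X, exists d : distance R X, F d = P.

Definition monotonic_consistency (R : realType) (X : finType)
    (F : clustering_algorithm R X) : Prop :=
  forall d d' : distance R X,
    monotonic_transformation (F d) d d' -> F d' = F d.

Lemma expansive_bij (R : realType) (eta : R -> R) :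
  expansive eta -> eta 0 = 0 -> set_bij `[0, +oo[ `[0, +oo[ eta.
Proof.
move=> [eta_ge0 eta_cont eta_exp] eta0; split.
- by move=> t /=; rewrite !in_itv/= !andbT; exact: eta_ge0.
- move=> s t /set_mem/=; rewrite in_itv/= andbT => s0.
  move=> /set_mem/=; rewrite in_itv/= andbT => t0 est.
  have := eta_exp s t s0 t0; rewrite est subrr normr0 normr_le0 subr_eq0.
  by move/eqP.
- move=> v /=; rewrite in_itv/= andbT => v0.
  have v_le : v <= eta v.
    have := eta_exp v 0 v0 (lexx 0).
    by rewrite eta0 !subr0 !ger0_norm// eta_ge0.
  have cont : {within `[0, v], continuous eta}.
    apply: continuous_subspaceW eta_cont => t /=.
    by rewrite !in_itv/= andbT => /andP[].
  have v_in : Num.min (eta 0) (eta v) <= v <= Num.max (eta 0) (eta v).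
    by rewrite eta0 ge_min le_max v0 v_le orbT.
  have [t] := IVT v0 cont v_in.
  rewrite in_itv/= => /andP[t0 _] <-.
  by exists t => //=; rewrite in_itv/= andbT.
Qed.

Lemma monotonic_transformation_eta0 (R : realType) (X : finType)
    (P : partition_of X) (eta : R -> R) (d d' : distance R X) (x : X) :
  transforms_by P eta d d' -> eta 0 = 0.
Proof.
move=> /(_ x x)[+ _].
rewrite (dist_eq0 d x x).2// (dist_eq0 d' x x).2// => eta0; apply/esym/eta0.
rewrite /same_cluster finset.mem_pblock (finset.cover_partition (valP P)).
exact: finset.in_setT.
Qed.

(* Main.v *)
Require Import Defs.
From mathcomp Require Import all_boot all_order all_algebra.
From mathcomp Require Import all_classical all_reals all_analysis.

(** Join the pairs of points at minimal nonzero distance.  If the resulting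
    graph is a disjoint union of cliques, these cliques are the clusters;
    otherwise every cluster is a singleton.  In the first case a monotonic
    transformation keeps the minimal edges tied, does not lengthen them and does
    not shorten any other edge; in the second case it is an increasing
    reparametrisation of all the distances.  Either way the minimal edges stay
    the same.  The partition into singletons is only reached because a path with
    two edges is not a union of cliques, which takes three points. *)

Set Implicit Arguments.
Unset Strict Implicit.
Unset Printing Implicit Defensive.

Import Order.TTheory GRing.Theory Num.Theory.
Import numFieldNormedType.Exports.

Local Open Scope classical_set_scope.
Local Open Scope ring_scope.

(** * Expansive maps of the half-line that fix 0 *)

Section Expansive.
Variables (R : realType) (eta : R -> R).
Hypotheses (eta_exp : expansive eta) (eta0 : eta 0 = 0).

Lemma expansive_inj s t : 0 <= s -> 0 <= t -> eta s = eta t -> s = t.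
Proof.
case: eta_exp => _ _ le_eta s0 t0 est; apply/eqP.
by rewrite -subr_eq0 -normr_le0 (le_trans (le_eta s t s0 t0))// est subrr normr0.
Qed.

Lemma expansive_ge_id t : 0 <= t -> t <= eta t.
Proof.
case: eta_exp => eta_ge0 _ le_eta t0; have := le_eta t 0 t0 (lexx 0).
by rewrite eta0 !subr0 !ger0_norm ?eta_ge0.
Qed.

(** A continuous injective map starting at its least value must increase: if [eta t <= eta s], the
    intermediate value theorem on [[0, s]] gives some [r <= s] with [eta r = eta t], and injectivity
    forces [r = t]. *)
Lemma expansive_lt s t : 0 <= s -> s < t -> eta s < eta t.
Proof.
case: eta_exp => eta_ge0 eta_cont _ s0 st; rewrite ltNge; apply/negP => ts.
have t0 : 0 <= t by rewrite ltW// (le_lt_trans s0).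
have cont : {within `[0, s], continuous eta}.
  apply: continuous_subspaceW eta_cont => r /=.
  by rewrite !in_itv/= andbT => /andP[].
have t_in : Num.min (eta 0) (eta s) <= eta t <= Num.max (eta 0) (eta s).
  by rewrite eta0 ge_min le_max ts eta_ge0 // orbT.
have [r] := IVT s0 cont t_in.
rewrite in_itv/= => /andP[r0 rs] /(expansive_inj r0 t0) rt.
by move: st; rewrite -rt ltNge rs.
Qed.

Lemma expansive_le s t : 0 <= s -> 0 <= t -> (eta s <= eta t) = (s <= t).
Proof.
move=> s0 t0; case: (leP s t) => [|ts].
  by rewrite le_eqVlt => /predU1P[->|/(expansive_lt s0)/ltW->//]; rewrite lexx.
by apply/negbTE; rewrite -ltNge expansive_lt.
Qed.

(** Surjectivity onto the half-line gives a right inverse. It turns the condition on pairs in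
    different clusters into [d' x y = eta (d x y)]. *)
Lemma half_line_invK v : 0 <= v -> eta (half_line_inv eta v) = v.
Proof.
move=> v0; have [_ _ surj] := expansive_bij eta_exp eta0.
by rewrite /half_line_inv (surjpK _ surj)// inE /= in_itv /= v0.
Qed.

End Expansive.

(** * Partitions and equivalence relations *)

Section Clusters.
Variable X : finType.

Lemma same_cluster_equivalence (P : partition_of X) :
  equivalence_rel (same_cluster P).
Proof.
have [trivP] := (partition_trivIset (valP P), cover_partition (valP P)).
move=> covP x y z.
have memx u : u \in finset.cover (val P) by rewrite covP finset.in_setT.
rewrite /same_cluster mem_pblock memx; split=> // yx.
by rewrite (same_pblock trivP yx).
Qed.

Variables (e : rel X) (e_equiv : equivalence_rel e).

Definition classes_of : partition_of X :=
  exist (fun P => finset.partition P [set: X]%SET)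
    (equivalence_partition e [set: X]%SET)
    (equivalence_partitionP (in3W e_equiv)).

Lemma same_cluster_classes_of : same_cluster classes_of =2 e.
Proof.
move=> x y.
by rewrite /same_cluster pblock_equivalence_partition ?finset.in_setT//; exact: in3W.
Qed.

Lemma classes_of_eq (P : partition_of X) :
  e =2 same_cluster P -> classes_of = P.
Proof.
move=> eP; apply/val_inj => /=.
rewrite -[RHS](equivalence_partition_pblock (valP P)).
by apply: eq_in_imset => x _; apply/setP => y; rewrite !inE; exact: eP.
Qed.

End Clusters.

(** * The graph of closest pairs and its cliques *)

Section ClosestPairs.
Variables (R : realType) (X : finType).
Implicit Types d : distance R X.

(* Holds on the diagonal, where the distance vanishes. *)
Definition closest d : rel X := fun x y =>
  [forall u, forall v, (u != v) ==> (d x y <= d u v)].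

Lemma closestP d x y :
  reflect (forall u v, u != v -> d x y <= d u v) (closest d x y).
Proof.
apply: (iffP forallP) => [xy u v uv|xy u].
  by have /forallP/(_ v)/implyP := xy u; exact.
by apply/forallP => v; apply/implyP; exact: xy.
Qed.

Lemma dist_id d x : d x x = 0. Proof. exact/(dist_eq0 d). Qed.

Lemma closest_refl d : reflexive (closest d).
Proof. by move=> x; apply/closestP => u v _; rewrite dist_id dist_ge0. Qed.

Lemma closest_sym d : symmetric (closest d).
Proof. by move=> x y; rewrite /closest dist_sym. Qed.

Lemma closest_exists d (x y : X) :
  x != y -> exists u v, u != v /\ closest d u v.
Proof.
move=> xy.
have [[u v] /= uv le_uv] :=
  @arg_minP _ _ _ (x, y) (fun p : X * X => p.1 != p.2) (fun p => d p.1 p.2) xy.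
by exists u, v; split=> //; apply/closestP => u' v' uv'; exact: le_uv (u', v') _.
Qed.

(** As [closest d] is reflexive and symmetric, transitivity says exactly that its graph is a
    disjoint union of cliques. *)
Definition closest_transitive d : bool :=
  [forall x, forall y, forall z, closest d x y ==> closest d y z ==> closest d x z].

Lemma closest_transitiveP d :
  reflect (transitive (closest d)) (closest_transitive d).
Proof.
apply: (iffP forallP) => [t y x z xy yz|t x].
  by have /forallP/(_ y)/forallP/(_ z)/implyP/(_ xy)/implyP/(_ yz) := t x.
apply/forallP => y; apply/forallP => z.
by apply/implyP => xy; apply/implyP; exact: t.
Qed.

Definition clique_rel d : rel X := fun x y =>
  if closest_transitive d then closest d x y else x == y.

Lemma clique_rel_equivalence d : equivalence_rel (clique_rel d).
Proof.
rewrite /clique_rel; case: closest_transitiveP => [tr|_] x y z; last first.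
  by split=> [|/eqP->].
split; first exact: closest_refl.
by move=> xy; apply/idP/idP; apply: tr; rewrite // closest_sym.
Qed.

Lemma eq_clique_rel d d' :
  closest d =2 closest d' -> clique_rel d =2 clique_rel d'.
Proof.
move=> dd' x y; rewrite /clique_rel dd'.
suff -> : closest_transitive d = closest_transitive d' by [].
by apply: eq_forallb => u; do 2!apply: eq_forallb => ?; rewrite !dd'.
Qed.

Definition cliques : clustering_algorithm R X :=
  fun d => classes_of (clique_rel_equivalence d).

Lemma same_cluster_cliques d : same_cluster (cliques d) =2 clique_rel d.
Proof. exact: same_cluster_classes_of. Qed.

(** The algorithm sees a distance only through its closest pairs, so both invariance axioms reduce
    to preserving these. *)
Lemma eq_cliques d d' : closest d =2 closest d' -> cliques d = cliques d'.
Proof.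
move=> dd'; apply: classes_of_eq => x y.
by rewrite same_cluster_cliques; exact: eq_clique_rel.
Qed.

Lemma cliques_scale_invariance : scale_invariance cliques.
Proof.
move=> d a a0; apply: eq_cliques => x y.
apply: eq_forallb => u; apply: eq_forallb => v.
by rewrite /= ler_pM2l.
Qed.

Lemma closest_increasing (eta : R -> R) d d' :
  expansive eta -> eta 0 = 0 -> (forall x y, d' x y = eta (d x y)) ->
  closest d' =2 closest d.
Proof.
move=> eta_exp eta0 d'E x y; apply: eq_forallb => u; apply: eq_forallb => v.
by rewrite !d'E expansive_le ?dist_ge0.
Qed.

Lemma closest_transform (eta : R -> R) d d' :
  expansive eta -> eta 0 = 0 ->
  (forall x y, closest d x y -> d x y = eta (d' x y)) ->
  (forall x y, ~~ closest d x y -> d' x y = eta (d x y)) ->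
  closest d' =2 closest d.
Proof.
move=> eta_exp eta0 dE d'E x y.
have intra u v : closest d u v -> d' u v <= d u v.
  by move=> uv; rewrite dE ?expansive_ge_id ?dist_ge0.
have inter u v : ~~ closest d u v -> d u v <= d' u v.
  by move=> uv; rewrite d'E ?expansive_ge_id ?dist_ge0.
have [<-|xy] := eqVneq x y; first by rewrite !closest_refl.
apply/idP/idP => [c'xy|cxy].
  (* If [x y] were not closest for [d], comparing it with a closest pair [u v] would give
     [d x y <= d' x y <= d' u v <= d u v], which makes [x y] closest after all. *)
  apply: contraT => ncxy; have [u [v [uv cuv]]] := closest_exists d xy.
  have duv : d x y <= d u v.
    apply: le_trans (inter _ _ ncxy) _; apply: le_trans (intra _ _ cuv).
    by move/closestP: c'xy; exact.
  case/closestP: ncxy => u' v' uv'; apply: le_trans duv _.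
  by move/closestP: cuv; exact.
(* Against another closest pair, [eta] carries the comparison of [d] back to [d']; against any other
   pair, [d' x y <= d x y <= d u v <= d' u v]. *)
apply/closestP => u v uv; have [cuv|ncuv] := boolP (closest d u v).
  rewrite -(expansive_le eta_exp) ?dist_ge0// -!dE//.
  by move/closestP: cxy; exact.
apply: le_trans (intra _ _ cxy) _; apply: le_trans (inter _ _ ncuv).
by move/closestP: cxy; exact.
Qed.

Lemma cliques_monotonic_consistency : monotonic_consistency cliques.
Proof.
move=> d d' [eta eta_exp td]; apply: eq_cliques.
(* The value [eta 0 = 0] is read off at a point of [X]; over an empty [X] the claim is vacuous. *)
have [x0|noX] := pickP X; last by move=> x; have := noX x.
move=> _; have eta0 := monotonic_transformation_eta0 x0 td.
have invE x y : ~~ clique_rel d x y -> d' x y = eta (d x y).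
  rewrite -same_cluster_cliques => nxy.
  by rewrite (td x y).2// half_line_invK ?dist_ge0.
have dE x y : clique_rel d x y -> d x y = eta (d' x y).
  by rewrite -same_cluster_cliques => /(td x y).1.
move: invE dE; rewrite /clique_rel; case: closest_transitive => invE dE.
  exact: closest_transform dE invE.
(* Clusters are singletons here, so [invE] covers all pairs of distinct points; on the diagonal both
   sides are 0. *)
apply: (closest_increasing eta_exp eta0) => x y.
by have [<-|/invE//] := eqVneq x y; rewrite !dist_id eta0.
Qed.

(** * Distances realising a prescribed graph, and richness *)

Section TwoValued.
Variables (e : rel X) (e_sym : symmetric e).

Let two_valued_fun (x y : X) : R :=
  if x == y then 0 else if e x y then 1 else 2.

Let two_valued_sym x y : two_valued_fun x y = two_valued_fun y x.
Proof. by rewrite /two_valued_fun eq_sym e_sym. Qed.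

Let two_valued_ge0 x y : 0 <= two_valued_fun x y.
Proof. by rewrite /two_valued_fun; case: ifP => // _; case: ifP. Qed.

Let two_valued_eq0 x y : two_valued_fun x y = 0 <-> x = y.
Proof.
rewrite /two_valued_fun; case: eqVneq => [->//|/eqP xy]; split=> //.
by case: ifP => _ /eqP; rewrite ?oner_eq0 ?pnatr_eq0.
Qed.

Definition two_valued : distance R X :=
  Distance two_valued_sym two_valued_ge0 two_valued_eq0.

(** The edge [a b] makes 1 the minimal nonzero distance; with no edge, all pairs would tie at 2. *)
Lemma closest_two_valued a b x y : a != b -> e a b ->
  closest two_valued x y = (x == y) || e x y.
Proof.
move=> ab eab; have [<-|xy] := eqVneq x y; first by rewrite closest_refl.
apply/closestP/idP => /= [/(_ a b ab)|exy u v uv] /=; rewrite /two_valued_fun.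
  rewrite (negbTE xy) (negbTE ab) eab; case: ifP => // _.
  by rewrite lern1.
rewrite (negbTE xy) (negbTE uv) exy; case: ifP => // _.
by rewrite ler1n.
Qed.

End TwoValued.

Lemma cliques_richness : (2 < #|X|)%N -> richness cliques.
Proof.
move=> X3 P; have eqvP := same_cluster_equivalence P.
have reflP : reflexive (same_cluster P) by move=> x; exact: (eqvP x x x).1.
have symP : symmetric (same_cluster P).
  move=> x y; apply/idP/idP => xy.
    by rewrite -((eqvP x y x).2 xy) reflP.
  by rewrite -((eqvP y x y).2 xy) reflP.
have trP : transitive (same_cluster P).
  by move=> y x z xy yz; rewrite ((eqvP x y z).2 xy).
(* If some block has two points, the two-valued distance of [P] itself has the blocks as cliques;
   otherwise [P] consists of singletons. *)
have [/existsP[a /existsP[b /andP[ab eab]]]|noP] :=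
  boolP [exists a, exists b, (a != b) && same_cluster P a b].
  exists (two_valued symP); apply: classes_of_eq.
  have cE x y : closest (two_valued symP) x y = same_cluster P x y.
    by rewrite (closest_two_valued symP _ _ ab eab); case: eqVneq => // <-; rewrite reflP.
  move=> x y; rewrite /clique_rel; case: closest_transitiveP => [_|]//.
  by case=> v u w; rewrite !cE; exact: trP.
have eqE x y : same_cluster P x y = (x == y).
  apply/idP/eqP => [xy|->//]; apply/eqP; apply: contraNT noP => nxy.
  by apply/existsP; exists x; apply/existsP; exists y; rewrite nxy.
have [b [a [c [_ [ba ac cb]]]]] := card_gt2P X3.
(* The star centred at [a] contains the path [b], [a], [c] but no edge [b c], so transitivity fails
   and the algorithm falls back to singletons. *)
pose e : rel X := fun x y => (x == a) || (y == a).
have e_sym : symmetric e by move=> x y; rewrite /e orbC.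
have eba : e b a by rewrite /e eqxx orbT.
exists (two_valued e_sym); apply: classes_of_eq => x y.
rewrite /clique_rel; case: closest_transitiveP => // tr.
have : closest (two_valued e_sym) b c.
  by apply: (tr a); rewrite (closest_two_valued e_sym _ _ ba eba) /e eqxx ?orbT.
rewrite (closest_two_valued e_sym _ _ ba eba) /e.
by rewrite eq_sym (negbTE cb) (negbTE ba) eq_sym (negbTE ac).
Qed.

End ClosestPairs.

Theorem corollary16 (R : realType) (X : finType) (hX : (2 < #|X|)%N) :
  exists F : clustering_algorithm R X,
    scale_invariance F /\ richness F /\ monotonic_consistency F.
Proof.
exists (@cliques R X); split; first exact: cliques_scale_invariance.
by split; [exact: cliques_richness | exact: cliques_monotonic_consistency].
Qed.
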